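(* Let $n$ be a positive integer. Every Latin square $L$ of order $n$ contains a critical set of size less than $n^2 - n\frac{\sqrt{n\pi}}{2}$.
   Context: A Latin square of order $n$ is an $n\times n$ array with entries from $X=\{1,\dots,n\}$ in which each element of $X$ occurs exactly once in each row and exactly once in each column; it is identified with the set of triples $(i,j;k)$ such that symbol $k$ occurs in cell $(i,j)$. A partial Latin square of order $n$ is an $n\times n$ array, some cells possibly empty, with entries from $X$ such that each element occurs at most once in each row and at most once in each column (again viewed as a set of triples); its size is the number of filled cells. A partial Latin square $C$ contained in a Latin square $L$ is uniquely completable if $L$ is the only Latin square of order $n$ containing $C$ (i.e., having $k$ in cell $(i,j)$ for every $(i,j;k)\in C$). A critical set in $L$ is a partial Latin square $C\subseteq L$ that is uniquely completable and such that no proper subset of $C$ is uniquely completable. *)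

(* Defs.v *)
From HB Require Import structures.
From mathcomp Require Import all_boot all_order all_algebra.

Set Implicit Arguments.
Unset Strict Implicit.
Unset Printing Implicit Defensive.

(* Rows, columns and symbols are numbered 0, ..., n-1 rather than 1, ..., n. *)

Definition latin_square (n : nat) (L : 'M['I_n]_n) : Prop :=
  (forall i k : 'I_n, exists! j : 'I_n, L i j = k) /\
  (forall j k : 'I_n, exists! i : 'I_n, L i j = k).

(* The triple (i, j; k), i.e. symbol k in cell (i, j), is ((i, j), k). *)
Definition triple (n : nat) : finType := ('I_n * 'I_n * 'I_n)%type.

Definition triples (n : nat) (L : 'M['I_n]_n) : {set triple n} :=
  [set t : triple n | L t.1.1 t.1.2 == t.2].

(* The first condition says that P is an array (at most one symbol per cell);
   the number of filled cells is then #|P|. *)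
Definition partial_latin_square (n : nat) (P : {set triple n}) : Prop :=
  [/\ forall i j k k' : 'I_n, (i, j, k) \in P -> (i, j, k') \in P -> k = k',
      forall i j j' k : 'I_n, (i, j, k) \in P -> (i, j', k) \in P -> j = j'
    & forall i i' j k : 'I_n, (i, j, k) \in P -> (i', j, k) \in P -> i = i'].

Definition uniquely_completable (n : nat) (L : 'M['I_n]_n)
    (C : {set triple n}) : Prop :=
  C \subset triples L /\
  forall L' : 'M['I_n]_n, latin_square L' -> C \subset triples L' -> L' = L.

Definition critical_set (n : nat) (L : 'M['I_n]_n)
    (C : {set triple n}) : Prop :=
  [/\ partial_latin_square C,
      C \subset triples L,
      uniquely_completable L C
    & forall D : {set triple n}, D \proper C -> ~ uniquely_completable L D].

(* Main.v *)
(* Order the n^2 cells of L uniformly at random, and call a cell forced if each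
   symbol other than its own occurs earlier in its row or in its column.  Filling
   in cells in this order shows that the unforced entries determine L, so some
   subset of them is critical.

   The n - 1 other symbols give n - 1 disjoint pairs of cells, one cell in the row
   and one in the column, and a cell is forced if it is preceded by a member of each
   pair.  By inclusion-exclusion this has probability
     sum_j (-1)^j C(n-1, j) / (2j + 1) = prod_(1 <= k < n) 2k / (2k + 1),
   the Wallis integral of cos^(2n-1), which exceeds sqrt(pi / (4n)).  Hence some
   order forces more than n^2 sqrt(pi / (4n)) = n sqrt(n pi) / 2 cells. *)
Require Import Defs.
From HB Require Import structures.
From mathcomp Require Import all_boot all_order all_algebra perm.
From mathcomp Require Import boolp reals trigo.
From mathcomp Require Import ring lra.
Set Implicit Arguments.
Unset Strict Implicit.
Unset Printing Implicit Defensive.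

Import Order.TTheory GRing.Theory Num.Theory.
Local Open Scope ring_scope.

(** * Random orders on a finite set *)

(** A permutation [s] encodes a linear order on [T]: [prank s x] is the position of [x], so a
    uniform permutation is a uniform order. *)
Definition prank (T : finType) (s : {perm T}) (x : T) : nat := enum_rank (s x).

Lemma prank_inj (T : finType) (s : {perm T}) : injective (prank s).
Proof. by move=> x y /val_inj /enum_rank_inj /perm_inj. Qed.

Definition first_in (T : finType) (A : {set T}) (c : T) (s : {perm T}) : bool :=
  [forall x in A, prank s c <= prank s x]%N.

(** By symmetry: composing with [tperm c c'] exchanges the orders in which [c] and [c'] come first
    in [A], and every order has exactly one first element of [A]. *)
Lemma card_first_in (T : finType) (A : {set T}) (c : T) : c \in A ->
  (#|A| * #|[set s | first_in A c s]| = #|{perm T}|)%N.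
Proof.
move=> cA.
have swap c' : c' \in A ->
    #|[set s | first_in A c' s]| = #|[set s | first_in A c s]|.
  move=> c'A; have tA x : (tperm c c' x \in A) = (x \in A).
    by case: tpermP => [->|->|//]; rewrite cA c'A.
  rewrite -(card_imset _ (mulgI (tperm c c'))); apply: eq_card => s; rewrite inE.
  apply/imsetP/forall_inP => [[u /[!inE] /forall_inP uP ->] x xA | sP].
    by move: (uP _ (etrans (tA x) xA)); rewrite /prank !permM tpermL.
  exists (tperm c c' * s)%g; last by rewrite mulgA tperm2 mul1g.
  rewrite inE; apply/forall_inP => x xA.
  by move: (sP _ (etrans (tA x) xA)); rewrite /prank !permM tpermR.
rewrite -sum_nat_const -(eq_bigr _ swap).
under eq_bigr => x _ do rewrite -sum1dep_card.
rewrite (exchange_big_dep predT) //= -sum1_card; apply: eq_bigr => s _.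
have [x xA xmin] := arg_minnP (prank s) cA.
rewrite (bigD1 x) /=; last by apply/andP; split=> //; apply/forall_inP.
rewrite big1 ?addn0 // => y /andP[/andP[yA /forall_inP yP]] /eqP[].
by apply: (@prank_inj T s); apply/eqP; rewrite eqn_leq yP // xmin.
Qed.

(** * An alternating binomial sum as a product *)

Lemma sum_sign_bin (R : pzRingType) (m : nat) :
  \sum_(j < m.+2) (-1) ^+ j * 'C(m.+1, j)%:R = 0 :> R.
Proof.
rewrite -[RHS](expr0n R m.+1) -[in RHS](subrr (1 : R)).
rewrite exprBn_comm; last exact: commr1.
by apply: eq_bigr => j _; rewrite !expr1n !mulr1 mulr_natr.
Qed.

Definition wallis_prod (R : numFieldType) (m : nat) : R :=
  \prod_(k < m) (k.*2.+2%:R / k.*2.+3%:R).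

Arguments wallis_prod : clear implicits.

(** Both sides are the integral of (1 - x^2)^m over [0, 1]; its recurrence in m is derived here by
    algebra alone. *)
Lemma sum_sign_bin_odd (R : numFieldType) (m : nat) :
  \sum_(j < m.+1) (-1) ^+ j * 'C(m, j)%:R / j.*2.+1%:R =
  wallis_prod R m.
Proof.
rewrite /wallis_prod; elim: m => [|m IH].
  by rewrite big_ord_recl !big_ord0 bin0 !mulr1 divr1 addr0.
rewrite [RHS]big_ord_recr /= -{}IH.
set S := LHS.
have : m.*2.+3%:R * S = m.*2.+2%:R *
    \sum_(j < m.+1) (-1) ^+ j * 'C(m, j)%:R / j.*2.+1%:R.
  (* Adding the vanishing alternating sum makes the two sides agree term by term, since (2m+2) C(m,
     j) = ((2m+3) - (2j+1)) C(m+1, j). *)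
  have /esym z := sum_sign_bin R m; rewrite -[RHS]addr0 [X in _ + X]z {z} [X in _ = X + _]mulr_sumr.
  rewrite [X in _ = _ + X]big_ord_recr /= addrA -big_split /=.
  rewrite /S mulr_sumr big_ord_recr /=.
  congr (_ + _).
    apply: eq_bigr => j _.
    have jm : (j <= m.+1)%N by apply: ltnW.
    have e : m.*2.+2%:R * 'C(m, j)%:R =
        (m.*2.+3%:R - j.*2.+1%:R) * 'C(m.+1, j)%:R :> R.
      rewrite -natrB; last by rewrite ltnS -doubleS leq_double.
      rewrite -!natrM subSS -doubleS -doubleB -!mul2n -!mulnA.
      by rewrite -mul_bin_down.
    have -> : m.*2.+2%:R * ((-1) ^+ j * 'C(m, j)%:R / j.*2.+1%:R) =
      (-1) ^+ j * (m.*2.+2%:R * 'C(m, j)%:R) / j.*2.+1%:R :> R by ring.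
    rewrite e; field.
    by rewrite addrC natr1 pnatr_eq0.
  by rewrite binn doubleS mulrC divfK ?pnatr_eq0.
move=> e; apply: (mulfI (_ : m.*2.+3%:R != 0)); first by rewrite pnatr_eq0.
rewrite e; field.
by rewrite -?natrM -?natrD pnatr_eq0.
Qed.

Lemma sum_over_card (R : nmodType) (K : finType) (f : nat -> R) :
  \sum_(J : {set K}) f #|J| = \sum_(j < #|K|.+1) f j *+ 'C(#|K|, j).
Proof.
rewrite (partition_big (fun J : {set K} => inord #|J| : 'I_#|K|.+1) predT) //=.
apply: eq_bigr => j _.
have cJ (J : {set K}) : (inord #|J| == j) = (#|J| == j).
  by rewrite -val_eqE /= inordK // ltnS max_card.
under eq_bigl => J do rewrite cJ.
under eq_bigr => J /eqP -> do [].
by rewrite sumr_const -card_draws cardsE.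
Qed.

(** * Probability of being preceded by a member of each pair *)

Definition preceded (T K : finType) (a b : K -> T) (c : T) (s : {perm T}) : bool :=
  [forall k, (prank s (a k) < prank s c) || (prank s (b k) < prank s c)]%N.

(* Inclusion-exclusion over the set of pairs neither member of which precedes
   [c]: such a set [J] makes [c] first among [2 * #|J| + 1] elements. *)
Lemma sum_preceded (R : numFieldType) (T K : finType) (a b : K -> T) (c : T) :
    injective a -> injective b -> (forall k k', a k != b k') ->
    (forall k, a k != c) -> (forall k, b k != c) ->
  \sum_(s : {perm T}) (preceded a b c s)%:R =
  #|{perm T}|%:R * wallis_prod R #|K|.
Proof.
move=> inja injb ab ac bc.
pose A (J : {set K}) := c |: (a @: J :|: b @: J).
have cardA J : #|A J| = #|J|.*2.+1.
  rewrite cardsU1 inE negb_or.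
  have -> : c \notin a @: J.
    by apply/imsetP => -[k _ e]; move: (ac k); rewrite -e eqxx.
  have -> : c \notin b @: J.
    by apply/imsetP => -[k _ e]; move: (bc k); rewrite -e eqxx.
  rewrite cardsU !card_imset // addnn [_ :&: _](_ : _ = set0).
    by rewrite cards0 subn0.
  apply/setP => x; rewrite !inE; apply/negP => /andP[/imsetP[k _ ->]].
  by case/imsetP => k' _ e; move: (ab k k'); rewrite e eqxx.
have expand s : (preceded a b c s)%:R =
    \sum_(J : {set K}) (-1) ^+ #|J| * (first_in (A J) c s)%:R :> R.
  pose late k : bool :=
    ((prank s c <= prank s (a k)) && (prank s c <= prank s (b k)))%N.
  (* The indicator is the product of the factors 1 - [late k]; expanding it gives one term for each
     set [J] of late pairs. *)
  have -> : (preceded a b c s)%:R = \prod_k (- (late k)%:R + 1) :> R.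
    have [/forallP p|] := boolP (preceded a b c s).
      rewrite big1 // => k _; move: (p k); rewrite /late !ltnNge -negb_and.
      by move=> /negPf ->; rewrite oppr0 add0r.
    rewrite negb_forall => /existsP[k].
    rewrite negb_or -!leqNgt => lk.
    by rewrite (bigD1 k) //= /late lk addNr mul0r.
  rewrite bigA_distr; apply: eq_bigr => J _.
  rewrite -big_mkcond /= prodrN; congr (_ * _).
  have [/forall_inP p|] := boolP (first_in (A J) c s).
    rewrite big1 // => k kJ.
    by rewrite /late !p // !inE imset_f ?orbT.
  rewrite negb_forall => /existsP[x]; rewrite negb_imply !inE => /andP[xA lx].
  have [k kJ /negPf lk] : exists2 k, k \in J & ~~ late k.
    move: xA lx => /or3P[/eqP ->|/imsetP[k kJ ->]|/imsetP[k kJ ->]] lx.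
    - by rewrite leqnn in lx.
    - by exists k => //; rewrite /late negb_and lx.
    - by exists k => //; rewrite /late negb_and lx orbT.
  by rewrite (bigD1 k) //= lk mul0r.
under eq_bigr => s _ do rewrite expand.
rewrite exchange_big /=.
have inner (J : {set K}) :
    \sum_(s : {perm T}) (-1) ^+ #|J| * (first_in (A J) c s)%:R =
    #|{perm T}|%:R * ((-1) ^+ #|J| / #|J|.*2.+1%:R) :> R.
  rewrite -mulr_sumr.
  have -> : \sum_s (first_in (A J) c s)%:R = #|[set s | first_in (A J) c s]|%:R :> R.
    rewrite -sum1dep_card natr_sum [RHS]big_mkcond /=.
    by apply: eq_bigr => s _; case: ifP.
  rewrite -(card_first_in (setU11 c _ : c \in A J)) cardA natrM.
  field.
  by rewrite addrC natr1 pnatr_eq0.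
under eq_bigr => J _ do rewrite inner.
rewrite -mulr_sumr (sum_over_card K (fun j => (-1) ^+ j / j.*2.+1%:R)).
rewrite -sum_sign_bin_odd; congr (_ * _); apply: eq_bigr => j _.
by rewrite -[LHS]mulr_natr mulrAC.
Qed.

(** * Latin squares and their critical subsets *)

(** [col i k] is the column of symbol [k] in row [i], and [row j k] its row in column [j]. *)
Lemma latin_square_inverses (n : nat) (L : 'M['I_n]_n) : latin_square L ->
  exists col row : 'I_n -> 'I_n -> 'I_n,
    [/\ forall i, cancel (L i) (col i), forall i, cancel (col i) (L i),
        forall j, cancel (L^~ j) (row j) & forall j, cancel (row j) (L^~ j)].
Proof.
case=> Lr Lc.
have ir i : injective (L i).
  by move=> j j' e; have [x [_ u]] := Lr i (L i j); rewrite -(u j) // -(u j').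
have ic j : injective (L^~ j).
  by move=> i i' e; have [x [_ u]] := Lc j (L i j); rewrite -(u i) // -(u i').
exists (fun i => invF (@ir i)), (fun j => invF (@ic j)).
by split=> x; [apply: invF_f|apply: f_invF|apply: (invF_f (@ic x))|
               apply: (f_invF (@ic x))].
Qed.

Lemma sub_triples_partial (n : nat) (L : 'M['I_n]_n) (C : {set triple n}) :
  latin_square L -> C \subset triples L -> partial_latin_square C.
Proof.
move=> /latin_square_inverses[col [row [LK _ cK _]]] /subsetP CL.
have E i j k : (i, j, k) \in C -> L i j = k by move=> /CL /[!inE] /eqP.
split=> [i j k k' /E <- /E <-|i j j' k /E e /E e'|i i' j k /E e /E e'] //.
  by rewrite -(LK i j) e -e' LK.
by rewrite -(cK j i) /= e -e' (cK j i').
Qed.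

(** Take an inclusion-minimal uniquely completable subset of [C]. *)
Lemma critical_subset (n : nat) (L : 'M['I_n]_n) (C : {set triple n}) :
  latin_square L -> uniquely_completable L C ->
  exists2 D : {set triple n}, critical_set L D & D \subset C.
Proof.
move=> Llat ucC.
pose P D := `[< uniquely_completable L D >].
have /minset_exists[D /minsetP[/asboolP ucD minD] DC] : P C by apply/asboolP.
exists D => //; have [DL _] := ucD.
split=> //; first exact: sub_triples_partial DL.
move=> E /properP[ED [x xD xE]] /asboolP ucE.
by move: xE; rewrite (minD E ucE ED) xD.
Qed.

(** * Forced cells of a Latin square *)

Section Forced.
Variables (n : nat) (L : 'M['I_n]_n) (col row : 'I_n -> 'I_n -> 'I_n).
Hypotheses (colK : forall i, cancel (col i) (L i)).
Hypotheses (rowK : forall j, cancel (row j) (L^~ j)).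

Definition cell : finType := ('I_n * 'I_n)%type.

Definition other (c : cell) : finType := {k : 'I_n | k != L c.1 c.2}.

Definition row_cell (c : cell) (k : other c) : cell := (c.1, col c.1 (val k)).
Definition col_cell (c : cell) (k : other c) : cell := (row c.2 (val k), c.2).

Definition forced (s : {perm cell}) (c : cell) : bool :=
  preceded (@row_cell c) (@col_cell c) c s.

Definition unforced_triples (s : {perm cell}) : {set triple n} :=
  [set (c, L c.1 c.2) | c in [pred c | ~~ forced s c]].

Lemma row_cell_neq (c : cell) (k : other c) : row_cell k != c.
Proof.
apply: contraNneq (valP k) => e.
by rewrite -[in X in _ == X]e /= colK.
Qed.

Lemma col_cell_neq (c : cell) (k : other c) : col_cell k != c.
Proof.
apply: contraNneq (valP k) => e.
by rewrite -[in X in _ == X]e /= rowK.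
Qed.

Lemma row_cell_col_cell_neq (c : cell) (k k' : other c) :
  row_cell k != col_cell k'.
Proof.
apply: contraNneq (row_cell_neq k) => -[_ e2].
by rewrite /row_cell e2 -surjective_pairing.
Qed.

Lemma row_cell_inj (c : cell) : injective (@row_cell c).
Proof. by move=> k k' [/(can_inj (colK _)) /val_inj]. Qed.

Lemma col_cell_inj (c : cell) : injective (@col_cell c).
Proof. by move=> k k' [/(can_inj (rowK _)) /val_inj]. Qed.

Lemma card_other (c : cell) : #|other c| = n.-1.
Proof. by rewrite card_sig cardC1 card_ord. Qed.

Lemma sum_forced (R : numFieldType) (c : cell) :
  \sum_(s : {perm cell}) (forced s c)%:R =
  #|{perm cell}|%:R * wallis_prod R n.-1 :> R.
Proof.
rewrite /forced sum_preceded ?card_other //.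
- exact: row_cell_inj.
- exact: col_cell_inj.
- exact: row_cell_col_cell_neq.
- exact: row_cell_neq.
- exact: col_cell_neq.
Qed.

(* The cells are determined in the order [s]: when the turn of a forced cell
   comes, every symbol but one already occurs in its row or in its column. *)
Lemma unforced_triples_completable (s : {perm cell}) :
  uniquely_completable L (unforced_triples s).
Proof.
split.
  by apply/subsetP => _ /imsetP[c _ ->]; rewrite inE.
move=> L' /latin_square_inverses[col' [row' [L'K _ c'K _]]] /subsetP CL'.
suff agree m (c : cell) : (prank s c < m)%N -> L' c.1 c.2 = L c.1 c.2.
  by apply/matrixP => i j; apply: (agree (prank s (i, j)).+1 (i, j)).
elim: m c => [//|m IH] c; rewrite ltnS => cm.
have [/forallP fc|nfc] := boolP (forced s c); last first.
  have /CL' : (c, L c.1 c.2) \in unforced_triples s by apply: imset_f.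
  by rewrite inE => /eqP.
(* If [L'] had another symbol in [c], then [L] has that symbol in an earlier cell of the same row or
   column. By induction [L'] has it there too, hence twice in one line. *)
apply/eqP; apply/negPn/negP => neq.
have [lt|lt] := orP (fc (exist _ (L' c.1 c.2) neq)).
  have := IH _ (leq_trans lt cm); rewrite /= colK => /(can_inj (L'K _)) e.
  by case/eqP: (neq); rewrite -[in RHS]e colK.
have := IH _ (leq_trans lt cm); rewrite /= (rowK c.2) => /(can_inj (c'K _)) e.
by case/eqP: (neq); rewrite -[in RHS]e (rowK c.2).
Qed.

Lemma card_unforced_triples (s : {perm cell}) :
  (#|unforced_triples s| + #|[set c | forced s c]| = n ^ 2)%N.
Proof.
rewrite card_imset; last by move=> c c' [].
by rewrite cardsE addnC cardC card_prod card_ord.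
Qed.

(** Averaging: if every order forced fewer cells, the total over all orders would contradict
    [sum_forced]. *)
Lemma exists_many_forced (R : realFieldType) :
  exists s, n%:R ^+ 2 * wallis_prod R n.-1 <= #|[set c | forced s c]|%:R.
Proof.
apply/not_existsP => few.
have : \sum_s #|[set c | forced s c]|%:R <
    \sum_(s : {perm cell}) n%:R ^+ 2 * wallis_prod R n.-1.
  apply: ltr_sum; last by move=> s _; rewrite ltNge; apply/negP/few.
  by apply/hasP; exists 1%g; rewrite ?mem_index_enum.
have count s : #|[set c | forced s c]|%:R = \sum_c (forced s c)%:R :> R.
  rewrite -sum1dep_card natr_sum big_mkcond /=.
  by apply: eq_bigr => c _; case: ifP.
under eq_bigr => s _ do rewrite count.
rewrite exchange_big /=.
under eq_bigr => c _ do rewrite sum_forced.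
rewrite !sumr_const card_prod card_ord.
have -> : #|(xpredT : pred {perm cell})| = #|{perm cell}| by apply: eq_card.
move: #|{perm cell}| => N.
by rewrite -!(mulr_natl (_ * _)) natrM expr2 mulrCA ltxx.
Qed.
End Forced.

(* Wallis integrals *)
From mathcomp Require Import classical_sets functions topology normedtype derive.
Import numFieldNormedType.Exports.

(** The primitive of cos^m vanishing at 0, given by the reduction formula, so that only derivatives
    need to be handled. *)
Fixpoint cos_pow_prim (R : realType) (m : nat) (x : R) : R :=
  match m with
  | 0 => x
  | 1 => sin x
  | (m'.+1 as p).+1 =>
      (cos x ^+ p * sin x + p%:R * cos_pow_prim m' x) / m%:R
  end.

Arguments cos_pow_prim : clear implicits.

Lemma nat2_ind (P : nat -> Prop) :
  P 0%N -> P 1%N -> (forall m, P m -> P m.+2) -> forall m, P m.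
Proof.
move=> P0 P1 PS m; suff: P m /\ P m.+1 by case.
by elim: m => [//|m [Pm PmS]]; split=> //; apply: PS.
Qed.

Lemma is_derive_cos_pow_prim (R : realType) (m : nat) (x : R) :
  is_derive x 1 (cos_pow_prim R m) (cos x ^+ m).
Proof.
elim/nat2_ind: m => [||m IH].
- exact: is_derive_id.
- exact: is_derive_sin.
have -> : cos_pow_prim R m.+2 =
    m.+2%:R^-1 *: ((@cos R) ^+ m.+1 * (@sin R) + m.+1%:R *: cos_pow_prim R m).
  by apply/funext => y; rewrite /= mulrC !fctE.
apply: is_derive_eq.
rewrite /GRing.scale /= !fctE.
have s2 : sin x * sin x = 1 - cos x ^+ 2 by rewrite -(cos2Dsin2 x); ring.
have -> : m.+2%:R = m%:R + 2 :> R by rewrite -addn2 natrD.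
have -> : m.+1%:R = m%:R + 1 :> R by rewrite -addn1 natrD.
have m2 : m%:R + 2 != 0 :> R by rewrite -natrD pnatr_eq0 addn2.
have -> : cos x ^+ m.+1 * cos x + sin x * ((m%:R + 1) * cos x ^+ m * - sin x) =
   cos x ^+ m.+1 * cos x - (m%:R + 1) * cos x ^+ m * (sin x * sin x) by ring.
rewrite s2 !exprS; field.
exact: m2.
Qed.

(** The integral of cos^m over [0, pi/2]. *)
Definition wallis (R : realType) (m : nat) : R := cos_pow_prim R m (pi / 2).

Arguments wallis : clear implicits.

Lemma wallisSS (R : realType) (m : nat) :
  wallis R m.+2 = m.+1%:R / m.+2%:R * wallis R m.
Proof. by rewrite /wallis /= cos_pihalf expr0n mul0r add0r mulrAC. Qed.

Lemma wallis_ge0 (R : realType) (m : nat) : 0 <= wallis R m.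
Proof.
elim/nat2_ind: m => [||m IH].
- by rewrite /wallis /= divr_ge0 // pi_ge0.
- by rewrite /wallis /= sin_pihalf.
- by rewrite wallisSS mulr_ge0 // divr_ge0.
Qed.

Lemma cos_pow_prim0 (R : realType) (m : nat) : cos_pow_prim R m 0 = 0.
Proof.
elim/nat2_ind: m => [||m IH] //=; first exact: sin0.
by rewrite sin0 IH !mulr0 addr0 mul0r.
Qed.

(** The mean value theorem is applied to the difference of the primitives, whose derivative cos^m (1
    - cos) is nonnegative on [0, pi/2]. *)
Lemma wallis_nonincr (R : realType) (m : nat) : wallis R m.+1 <= wallis R m.
Proof.
pose g : R -> R := cos_pow_prim R m - cos_pow_prim R m.+1.
have dg (x : R) : is_derive x 1 g (cos x ^+ m - cos x ^+ m.+1).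
  by apply: is_deriveB; apply: is_derive_cos_pow_prim.
have cg : {within `[0, pi / 2], continuous g}%classic.
  apply: continuous_subspaceT => x.
  by apply/differentiable_continuous/derivable1_diffP; case: (dg x).
have pi2 : (0 : R) <= pi / 2 by rewrite divr_ge0 // pi_ge0.
have [c] := MVT_segment pi2 (fun x _ => dg x) cg.
rewrite in_itv /= => /andP[c0 c1].
rewrite /g !fctE !cos_pow_prim0 subrr !subr0 => e.
rewrite -subr_ge0 /wallis e mulr_ge0 //.
have cc : 0 <= cos c by apply: cos_ge0_pihalf; rewrite c1 andbT; lra.
by rewrite exprS subr_ge0 ler_piMl ?exprn_ge0 // cos_le1.
Qed.

(** The reduction formula makes the left side independent of [m]; at 0 it is pi/2. *)
Lemma wallis_mulS (R : realType) (m : nat) :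
  wallis R m * wallis R m.+1 * m.+1%:R = pi / 2.
Proof.
elim: m => [|m <-]; first by rewrite /wallis /= sin_pihalf !mulr1.
rewrite wallisSS; field.
by rewrite -(natrD _ 2 m) pnatr_eq0.
Qed.

Lemma wallis_prodS (R : realType) (m : nat) :
  wallis_prod R m.+1 = wallis_prod R m * (m.*2.+2%:R / m.*2.+3%:R).
Proof. exact: big_ord_recr. Qed.

Lemma wallis_odd (R : realType) (m : nat) : wallis R m.*2.+1 = wallis_prod R m.
Proof.
elim: m => [|m IH]; first by rewrite /wallis_prod big_ord0 /wallis /= sin_pihalf.
by rewrite wallis_prodS doubleS wallisSS IH mulrC.
Qed.

Lemma wallis_prod_gt0 (R : realType) (m : nat) : 0 < wallis_prod R m.
Proof. by apply: prodr_gt0 => k _; rewrite divr_gt0. Qed.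

(** For consecutive Wallis integrals w >= w' of exponents 2m+1 and 2m+2, w w' (2m+2) = pi/2; replace
    w' by w. *)
Lemma wallis_prod_sqr_ge (R : realType) (m : nat) :
  pi / 4 <= wallis_prod R m ^+ 2 * m.+1%:R.
Proof.
have := wallis_mulS R m.*2.+1.
have := wallis_nonincr R m.*2.+1.
have := wallis_ge0 R m.*2.+1.
rewrite wallis_odd; set w := wallis_prod R m; set w' := wallis R _ => w0 w'w.
have -> : m.*2.+2%:R = 2 * m.+1%:R :> R by rewrite -doubleS -mul2n natrM.
set N : R := m.+1%:R => e.
have N0 : 0 <= N by rewrite ler0n.
have : w * w' * (2 * N) <= w * w * (2 * N).
  by rewrite ler_wpM2r ?mulr_ge0 // ler_wpM2l.
rewrite e expr2; lra.
Qed.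

(* The sequence [wallis_prod m ^ 2 * (m + 1)] strictly decreases to [pi / 4]. *)
Lemma wallis_prod_sqr_gt (R : realType) (m : nat) :
  pi / 4 < wallis_prod R m ^+ 2 * m.+1%:R.
Proof.
apply: le_lt_trans (wallis_prod_sqr_ge R m.+1) _.
rewrite wallis_prodS exprMn -mulrA ltr_pM2l ?exprn_gt0 ?wallis_prod_gt0 //.
have -> : m.*2.+2%:R = 2 * m%:R + 2 :> R by rewrite -addn2 natrD -mul2n natrM.
have -> : m.*2.+3%:R = 2 * m%:R + 3 :> R by rewrite -addn3 natrD -mul2n natrM.
have -> : m.+2%:R = m%:R + 2 :> R by rewrite -addn2 natrD.
have -> : m.+1%:R = m%:R + 1 :> R by rewrite -addn1 natrD.
have : 0 <= m%:R :> R by rewrite ler0n.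
move: (m%:R : R) => x x0.
rewrite expr_div_n mulrAC ltr_pdivrMr; last by rewrite exprn_gt0 //; lra.
rewrite -subr_gt0; set d := (X in 0 < X).
(* After clearing denominators, the decrease reads (2x+2)^2 (x+2) < (2x+3)^2 (x+1), and the two
   sides differ by exactly x + 1. *)
have -> : d = x + 1 by rewrite /d; ring.
lra.
Qed.

Theorem theorem1 (R : realType) (n : nat) (n_gt0 : (0 < n)%N)
    (L : 'M['I_n]_n) (L_latin : latin_square L) :
  exists C : {set triple n},
    critical_set L C /\
    (#|C|%:R : R) < n%:R ^+ 2 - n%:R * (Num.sqrt (n%:R * pi) / 2).
Proof.
have [col [row [_ colK _ rowK]]] := latin_square_inverses L_latin.
have [s many] := exists_many_forced colK rowK R.
have [C critC CU] := critical_subset L_latin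
  (unforced_triples_completable colK rowK s).
exists C; split=> //.
have := subset_leq_card CU; rewrite -(ler_nat R).
have /(congr1 (fun m => m%:R : R)) := card_unforced_triples L col row s.
rewrite natrD natrX => cardU leC.
have n0 : 0 < n%:R :> R by rewrite ltr0n.
(* [C] has at most n^2 minus the number of forced cells, so it remains to compare the forced count
   with the target. *)
suff : n%:R * (Num.sqrt (n%:R * pi) / 2) < n%:R ^+ 2 * wallis_prod R n.-1.
  lra.
rewrite expr2 -mulrA ltr_pM2l //.
have w0 := wallis_prod_gt0 R n.-1.
have := wallis_prod_sqr_gt R n.-1; rewrite prednK // => wlt.
rewrite ltr_pdivrMr //.
have nw : 0 <= n%:R * wallis_prod R n.-1 * 2 by rewrite !mulr_ge0 ?ltW.
(* Writing the right side as the root of its square reduces the claim to n pi < (2 n w)^2, that is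
   [wlt] multiplied by 4n. *)
rewrite -(ger0_norm nw) -sqrtr_sqr ltr_sqrt;
  last by rewrite exprn_gt0 // !mulr_gt0.
rewrite !exprMn expr2 -!mulrA ltr_pM2l //.
rewrite ltr_pdivrMr // in wlt.
apply: lt_le_trans wlt _; rewrite le_eqVlt; apply/orP; left; apply/eqP; ring.
Qed.
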